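(* If $D$ is a sharp TV domain, then $D$ is a Dedekind domain. In particular, if a sharp domain is Noetherian or Krull, then it is a Dedekind domain.
   Context: All rings are integral domains (commutative, unitary, without zero-divisors). A domain $D$ is called a sharp domain if whenever $I \supseteq AB$ with $I, A, B$ nonzero ideals of $D$, there exist ideals $A' \supseteq A$ and $B' \supseteq B$ of $D$ such that $I = A'B'$. Let $K$ be the quotient field of $D$. For a nonzero fractional ideal $I$ of $D$, put $I^{-1} = \{x \in K \mid xI \subseteq D\}$; the $v$-closure of $I$ is $I_v = (I^{-1})^{-1}$, and $I$ is a $v$-ideal if $I = I_v$. The $t$-closure $I_t$ of $I$ is the union of the $v$-closures of the nonzero finitely generated subideals of $I$, and $I$ is a $t$-ideal if $I = I_t$. A TV domain is a domain in which every $t$-ideal is a $v$-ideal. A Dedekind domain is a domain in which every nonzero ideal is invertible; fields are regarded as Dedekind domains. *)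

(* Defs.v *)
From HB Require Import structures.
From mathcomp Require Import all_boot all_order all_algebra.
From mathcomp Require Import boolp classical_sets functions cardinality.

Set Implicit Arguments.
Unset Strict Implicit.
Unset Printing Implicit Defensive.

Import Order.TTheory GRing.Theory Num.Theory.
Local Open Scope classical_set_scope.
Local Open Scope ring_scope.

(* R is a D-module through f : D -> R.  Two cases are used: R = D with f = id
   (ideals of D), and R = {fraction D} with f = tofrac (fractional ideals). *)
Definition submodule (D R : comNzRingType) (f : D -> R) (N : set R) : Prop :=
  [/\ N 0, forall x y, N x -> N y -> N (x + y)
    & forall a x, N x -> N (f a * x)].

Definition span (D R : comNzRingType) (f : D -> R) (s : seq R) : set R :=
  [set x | exists c : nat -> D, x = \sum_(i < size s) f (c i) * s`_i].

Definition nonzero (R : comNzRingType) (N : set R) : Prop :=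
  exists2 x, N x & x != 0.

Definition mul_ideal (R : comNzRingType) (A B : set R) : set R :=
  [set x | exists s : seq (R * R),
     (forall p, p \in s -> A p.1 /\ B p.2) /\ x = \sum_(p <- s) p.1 * p.2].

(* Not necessarily proper. *)
Definition ideal (D : idomainType) (I : set D) : Prop := submodule id I.

Definition nonzero_ideal (D : idomainType) (I : set D) : Prop :=
  ideal I /\ nonzero I.

Definition sharp_domain (D : idomainType) : Prop :=
  forall I A B : set D,
    nonzero_ideal I -> nonzero_ideal A -> nonzero_ideal B ->
    mul_ideal A B `<=` I ->
    exists A' B' : set D,
      [/\ ideal A', ideal B', A `<=` A', B `<=` B' & I = mul_ideal A' B'].

Definition base (D : idomainType) : set {fraction D} := range (@tofrac D).
Arguments base : clear implicits.

Definition fractional_ideal (D : idomainType) (I : set {fraction D}) : Prop :=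
  submodule (@tofrac D) I /\
  exists2 d : D, d != 0 & forall x, I x -> base D (tofrac d * x).

Definition nonzero_fractional_ideal (D : idomainType)
    (I : set {fraction D}) : Prop :=
  fractional_ideal I /\ nonzero I.

Definition inv_ideal (D : idomainType) (I : set {fraction D}) :
    set {fraction D} :=
  [set x | forall y, I y -> base D (x * y)].

Definition v_closure (D : idomainType) (I : set {fraction D}) :
    set {fraction D} :=
  inv_ideal (inv_ideal I).

Definition v_ideal (D : idomainType) (I : set {fraction D}) : Prop :=
  nonzero_fractional_ideal I /\ I = v_closure I.

Definition t_closure (D : idomainType) (I : set {fraction D}) :
    set {fraction D} :=
  [set x | exists s : seq {fraction D},
     [/\ nonzero (span (@tofrac D) s), span (@tofrac D) s `<=` I
       & v_closure (span (@tofrac D) s) x]].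

Definition t_ideal (D : idomainType) (I : set {fraction D}) : Prop :=
  nonzero_fractional_ideal I /\ I = t_closure I.

Definition TV_domain (D : idomainType) : Prop :=
  forall I : set {fraction D}, t_ideal I -> v_ideal I.

Definition invertible (D : idomainType) (I : set {fraction D}) : Prop :=
  exists J : set {fraction D},
    nonzero_fractional_ideal J /\ mul_ideal I J = base D.

Definition Dedekind_domain (D : idomainType) : Prop :=
  forall I : set D, nonzero_ideal I -> invertible (@tofrac D @` I).

Definition Noetherian_domain (D : idomainType) : Prop :=
  forall I : set D, ideal I -> exists s : seq D, I = span id s.

(* Normalized (surjective) discrete valuations; the value at 0 is irrelevant. *)
Definition discrete_valuation (K : fieldType) (v : K -> int) : Prop :=
  [/\ forall x y, x != 0 -> y != 0 -> v (x * y) = v x + v y,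
      forall x y, x != 0 -> y != 0 -> x + y != 0 ->
        Num.min (v x) (v y) <= v (x + y)
    & forall n, exists2 x, x != 0 & v x = n].

(* D is an intersection of discrete valuation rings of its quotient field, with
   finite character.  The empty family is allowed, so fields are Krull. *)
Definition Krull_domain (D : idomainType) : Prop :=
  exists (T : Type) (v : T -> {fraction D} -> int),
    [/\ forall i, discrete_valuation (v i),
        forall x, x != 0 -> (base D x <-> forall i, 0 <= v i x)
      & forall x, x != 0 -> finite_set [set i | v i x != 0]].

(* Main.v *)
Require Import Defs.
From mathcomp Require Import all_boot all_order all_algebra.
From mathcomp Require Import boolp classical_sets cardinality.
From mathcomp Require Import ring.

(** A sharp domain is Pruefer and all its v-ideals are invertible; each of the
    three hypotheses then forces an arbitrary nonzero ideal to be invertible.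

    Every v-ideal is invertible ([sharp_v_closure_inverse]): for x <> 0 in A,
    the ideal xD contains A * (x A^-1), so xD = A'B' with A' containing A and
    B' containing x A^-1; then A' is invertible, and A' = A_v.

    Two invertible ideals A, B with (A + B)^-1 = D are comaximal
    ([coprime_comaximal]).  The ideal I = A + B^2 contains (A + B)^2, so
    sharpness factors it as I = A'B' with both factors containing A + B.
    Coprimality gives that A meets B in AB, and with it B A' lies in
    B (A + B), so A' = A + B, and likewise B' = A + B.  Hence
    A + B^2 = (A + B)^2.  An element of A is thus in A (A + B) up to an element
    of B^2 that is itself in A, hence in AB.  So A = A (A + B), and cancelling A
    gives A + B = D.

    For arbitrary invertible A, B, the v-ideal G = (A + B)_v is invertible, and
    A G^-1, B G^-1 are coprime, so comaximal: (A + B) G^-1 = D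
    ([sum_has_inverse]).  By induction every nonzero finitely generated ideal F
    is invertible ([span_has_inverse]), hence F = F_v
    ([has_inverse_v_closure]).

    Consequently every nonzero ideal is a t-ideal; under TV it is a v-ideal,
    hence invertible.  In a Noetherian domain every ideal is finitely generated.
    In a Krull domain every nonzero ideal I contains a finitely generated F with
    I inside F_v ([Krull_v_finite]), and F_v = F forces I = F.

    All computations take place among D-submodules of the quotient field, and
    cancellation of an invertible ideal is done elementwise, by
    [mem_of_mul_ideal1]. *)

Set Implicit Arguments.
Unset Strict Implicit.
Unset Printing Implicit Defensive.

Import Order.TTheory GRing.Theory Num.Theory.
Local Open Scope classical_set_scope.
Local Open Scope ring_scope.

Local Notation submod := (submodule (@tofrac _)).

(** * Submodules of the quotient field *)

Section Modules.
Variable D : idomainType.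
Local Notation K := {fraction D}.
Implicit Types (A B C I J N : set K) (x y : K).

Lemma base_tofrac (d : D) : base D (tofrac d).
Proof. by exists d. Qed.

Lemma base_submod : submod (base D).
Proof.
split; first by rewrite -tofrac0; exact: base_tofrac.
  by move=> _ _ [a _ <-] [b _ <-]; rewrite -tofracD; exact: base_tofrac.
by move=> a _ [b _ <-]; rewrite -tofracM; exact: base_tofrac.
Qed.

Lemma submod_mul N x y : submod N -> base D x -> N y -> N (x * y).
Proof. by case=> _ _ NZ [d _ <-]; apply: NZ. Qed.

Lemma submod_sub N x y : submod N -> N x -> N y -> N (x - y).
Proof.
move=> [_ ND NZ] Nx Ny; apply: ND => //.
by rewrite -mulN1r -tofrac1 -tofracN; apply: NZ.
Qed.

Lemma mem_mul_ideal (R : comNzRingType) (A B : set R) a b :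
  A a -> B b -> mul_ideal A B (a * b).
Proof.
move=> Aa Bb; exists [:: (a, b)]; rewrite big_seq1; split=> // p.
by rewrite inE => /eqP ->.
Qed.

Lemma mul_ideal_submod A B : submod A -> submod (mul_ideal A B).
Proof.
move=> sA; split; first by exists [::]; rewrite big_nil.
  move=> _ _ [s [hs ->]] [t [ht ->]]; exists (s ++ t); rewrite big_cat.
  by split=> // p; rewrite mem_cat => /orP[/hs|/ht].
move=> a _ [s [hs ->]]; exists [seq (tofrac a * p.1, p.2) | p <- s].
rewrite big_map mulr_sumr; split; last first.
  by apply: eq_bigr => p _; rewrite mulrA.
move=> _ /mapP[p /hs [Ap Bp] ->]; split=> //=.
by case: sA => _ _; apply.
Qed.

(** The universal property of the product: inclusions are checked on the
    generators a * b, without handling sums. *)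
Lemma mul_ideal_min N A B : submod N ->
  (forall a b, A a -> B b -> N (a * b)) -> mul_ideal A B `<=` N.
Proof.
move=> [N0 ND _] AB_N _ [s [hs ->]]; rewrite big_seq.
by apply: (big_ind N) => // p /hs[]; apply: AB_N.
Qed.

Lemma mul_ideal_scale N A B x y : submod N ->
  (forall a b, A a -> B b -> N (x * (a * b))) ->
  mul_ideal A B y -> N (x * y).
Proof.
move=> [N0 ND NZ] xAB; apply: (@mul_ideal_min [set z | N (x * z)] A B _ xAB y).
split=> /=; first by rewrite mulr0.
  by move=> u v Nu Nv; rewrite mulrDr; apply: ND.
by move=> a u Nu; rewrite mulrCA; apply: NZ.
Qed.

(** Cancellation of an invertible ideal: writing 1 as a sum of products a * j
    shows that membership in a submodule can be checked after multiplication by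
    each a * j.  With J = A^-1 this reduces A X <= A N to X <= N. *)
Lemma mem_of_mul_ideal1 A J N x : mul_ideal A J 1 -> submod N ->
  (forall a j, A a -> J j -> N (a * j * x)) -> N x.
Proof.
move=> AJ1 sN AJx; rewrite -[x]mulr1.
apply: mul_ideal_scale AJ1 => // a j Aa Jj.
by rewrite mulrC; apply: AJx.
Qed.

Definition sum_ideal A B : set K := [set a + b | a in A & b in B].

Lemma sum_ideal_submod A B : submod A -> submod B -> submod (sum_ideal A B).
Proof.
move=> [A0 AD AZ] [B0 BD BZ]; split.
- by exists 0 => //; exists 0 => //; rewrite addr0.
- move=> _ _ [a Aa [b Bb <-]] [c Ac [d Bd <-]].
  by exists (a + c); [exact: AD|exists (b + d); [exact: BD|rewrite addrACA]].
- move=> r _ [a Aa [b Bb <-]].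
  by exists (tofrac r * a); [exact: AZ
    |exists (tofrac r * b); [exact: BZ|rewrite mulrDr]].
Qed.

Lemma sum_idealL A B : submod B -> A `<=` sum_ideal A B.
Proof.
by case=> B0 _ _ a Aa; exists a => //; exists 0 => //; rewrite addr0.
Qed.

Lemma sum_idealR A B : submod A -> B `<=` sum_ideal A B.
Proof.
by case=> A0 _ _ b Bb; exists 0 => //; exists b => //; rewrite add0r.
Qed.

Lemma sum_ideal_min A B N : submod N -> A `<=` N -> B `<=` N ->
  sum_ideal A B `<=` N.
Proof.
by case=> _ ND _ AN BN _ [a /AN Na [b /BN Nb <-]]; apply: ND.
Qed.

Lemma inv_ideal_submod A : submod (inv_ideal A).
Proof.
have [B0 BD BZ] := base_submod; split=> /=.
- by move=> y _; rewrite mul0r.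
- by move=> x y ix iy z Az; rewrite mulrDl; apply: BD; [exact: ix|exact: iy].
- by move=> a x ix z Az; rewrite -mulrA; apply: BZ; exact: ix.
Qed.

Lemma sub_v_closure A : A `<=` v_closure A.
Proof. by move=> x Ax y; rewrite mulrC; apply. Qed.

(** * Invertible ideals *)

(** The product of A and A^-1 is always inside D, so invertibility of A amounts
    to 1 being in that product. *)
Definition has_inverse A := mul_ideal A (inv_ideal A) 1.

Lemma has_inverseI A J :
  mul_ideal A J `<=` base D -> mul_ideal A J 1 -> has_inverse A.
Proof.
move=> AJ_D [s [hs e1]]; exists s; split=> // p /hs[Ap Jp]; split=> // a Aa.
by rewrite mulrC; apply: AJ_D; exact: mem_mul_ideal.
Qed.

(** For x in A_v and a, j in A, A^-1, the product j * x is in D, so a * j * x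
    is in A. *)
Lemma has_inverse_v_closure A : submod A -> has_inverse A ->
  v_closure A `<=` A.
Proof.
move=> sA A1 x vx; apply: (mem_of_mul_ideal1 A1) => // a j Aa Jj.
by rewrite -mulrA mulrC; apply: submod_mul => //; rewrite mulrC; apply: vx.
Qed.

(** The images in the quotient field of the nonzero ideals of D. *)
Definition integral_ideal A := [/\ submod A, A `<=` base D & nonzero A].

Lemma has_inverse_invertible A :
  integral_ideal A -> has_inverse A -> invertible A.
Proof.
move=> [sA AD [x Ax xn0]] A1; exists (inv_ideal A); split.
  split; first (split; first exact: inv_ideal_submod).
    have [d _ dx] := AD _ Ax; exists d; first by rewrite -tofrac_eq0 dx.
    by move=> y; rewrite dx mulrC; apply.
  apply: contrapT => J0; have /eqP := oner_neq0 K; apply.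
  rewrite -[LHS]mulr1; apply: (mem_of_mul_ideal1 (N := [set 0]) A1) => /=.
    by split=> [//|y z -> ->|a y ->]; rewrite ?addr0 ?mulr0.
  move=> a j _ Jj; case: (eqVneq j 0) => [->|jn0]; first by rewrite mulr0 mul0r.
  by case: J0; exists j.
apply/seteqP; split.
  apply: mul_ideal_min => [|a j Aa]; first exact: base_submod.
  by rewrite mulrC; apply.
move=> y Dy; rewrite -[y]mulr1.
by apply: submod_mul => //; exact: mul_ideal_submod.
Qed.

(** * Sharpness *)

Lemma integral_ideal_image (I : set D) :
  nonzero_ideal I -> integral_ideal (@tofrac D @` I).
Proof.
move=> [[I0 ID IZ] [d Id dn0]]; split; first split.
- by exists 0 => //; rewrite tofrac0.
- move=> _ _ [a Ia <-] [b Ib <-].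
  by exists (a + b); [exact: ID|rewrite tofracD].
- by move=> r _ [a Ia <-]; exists (r * a); [exact: IZ|rewrite tofracM].
- by move=> _ [c _ <-]; exact: base_tofrac.
- by exists (tofrac d); [exists d|rewrite tofrac_eq0].
Qed.

Lemma integral_ideal_preimage A :
  integral_ideal A -> nonzero_ideal (@tofrac D @^-1` A).
Proof.
move=> [[A0 AD AZ] A_D [x Ax xn0]]; split; first split=> /=.
- by rewrite tofrac0.
- by move=> y z Ay Az; rewrite tofracD; exact: AD.
- by move=> a y Ay; rewrite tofracM; exact: AZ.
- have [d _ dx] := A_D _ Ax.
  by exists d; [rewrite /= dx|rewrite -tofrac_eq0 dx].
Qed.

Lemma image_preimage_tofrac A :
  A `<=` base D -> @tofrac D @` (@tofrac D @^-1` A) = A.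
Proof.
move=> AD; apply/seteqP; split; first by move=> _ [d Ad <-].
by move=> x Ax; have [d _ dx] := AD _ Ax; exists d => //=; rewrite dx.
Qed.

Lemma image_mul_ideal (I J : set D) :
  @tofrac D @` mul_ideal I J = mul_ideal (@tofrac D @` I) (@tofrac D @` J).
Proof.
apply/seteqP; split.
  move=> _ [_ [s [hs ->]] <-]; exists [seq (tofrac p.1, tofrac p.2) | p <- s].
  split; last first.
    by rewrite rmorph_sum big_map; apply: eq_bigr => p _; rewrite rmorphM.
  by move=> _ /mapP[p /hs [Ip Jp] ->]; split=> /=; [exists p.1|exists p.2].
move=> _ [s [hs ->]].
elim: s hs => [|p s IH] hs.
  rewrite big_nil; exists 0; rewrite ?tofrac0 //.
  by exists [::]; rewrite big_nil.
rewrite big_cons.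
have [|_ [t [ht ->]] <-] := IH.
  by move=> q qs; apply: hs; rewrite inE qs orbT.
have [|[a Ia <-] [b Jb <-]] := hs p; first by rewrite inE eqxx.
rewrite -tofracM -tofracD; exists (a * b + \sum_(q <- t) q.1 * q.2) => //.
exists ((a, b) :: t); rewrite big_cons; split=> // q.
by rewrite inE => /orP[/eqP -> //|/ht].
Qed.

Lemma sharp_integral I A B : sharp_domain D ->
  integral_ideal I -> integral_ideal A -> integral_ideal B ->
  mul_ideal A B `<=` I ->
  exists A' B', [/\ integral_ideal A', integral_ideal B', A `<=` A', B `<=` B'
    & I = mul_ideal A' B'].
Proof.
move=> sharp iI iA iB AB_I.
have [[_ ID _] [_ AD A0] [_ BD B0]] := And3 iI iA iB.
have [nA nB] := (integral_ideal_preimage iA, integral_ideal_preimage iB).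
have [A' [B' [sA' sB' AA' BB' E]]] : exists A' B' : set D,
    [/\ ideal A', ideal B',
    @tofrac D @^-1` A `<=` A', @tofrac D @^-1` B `<=` B'
    & @tofrac D @^-1` I = mul_ideal A' B'].
  apply: sharp => //; first exact: integral_ideal_preimage.
  move=> x ABx; apply: AB_I.
  rewrite -(image_preimage_tofrac AD) -(image_preimage_tofrac BD).
  by rewrite -image_mul_ideal; exists x.
exists (@tofrac D @` A'), (@tofrac D @` B'); split.
- apply: integral_ideal_image; split=> //.
  by case: nA => _ [d /AA' A'd d0]; exists d.
- apply: integral_ideal_image; split=> //.
  by case: nB => _ [d /BB' B'd d0]; exists d.
- by rewrite -(image_preimage_tofrac AD); exact: image_subset.
- by rewrite -(image_preimage_tofrac BD); exact: image_subset.
- by rewrite -(image_preimage_tofrac ID) E image_mul_ideal.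
Qed.

Definition principal x : set K := [set tofrac c * x | c in [set: D]].

Lemma principal_submod x : submod (principal x).
Proof.
split; first by exists 0 => //; rewrite tofrac0 mul0r.
  by move=> _ _ [a _ <-] [b _ <-]; exists (a + b) => //; rewrite tofracD mulrDl.
by move=> a _ [b _ <-]; exists (a * b) => //; rewrite tofracM mulrA.
Qed.

Lemma mem_principal x : principal x x.
Proof. by exists 1 => //; rewrite tofrac1 mul1r. Qed.

Lemma principal_min N x : submod N -> N x -> principal x `<=` N.
Proof. by case=> _ _ NZ Nx _ [c _ <-]; apply: NZ. Qed.

Lemma principal_div x y : x != 0 -> principal x y -> base D (x^-1 * y).
Proof.
by move=> x0 [c _ <-]; rewrite mulrCA mulVf // mulr1; exact: base_tofrac.
Qed.

Lemma principal_has_inverse x : x != 0 -> has_inverse (principal x).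
Proof.
move=> x0; rewrite /has_inverse -(mulfV x0); apply: mem_mul_ideal.
  exact: mem_principal.
by move=> y; exact: principal_div.
Qed.

Lemma principal_integral x : base D x -> x != 0 -> integral_ideal (principal x).
Proof.
move=> Dx x0; split; first exact: principal_submod.
  by apply: principal_min => //; exact: base_submod.
by exists x => //; exact: mem_principal.
Qed.

Lemma sum_integral A B :
  integral_ideal A -> integral_ideal B -> integral_ideal (sum_ideal A B).
Proof.
move=> [sA AD [x Ax x0]] [sB BD _]; split; first exact: sum_ideal_submod.
  by apply: sum_ideal_min => //; exact: base_submod.
by exists x => //; exact: sum_idealL.
Qed.

Lemma mul_integral A B : integral_ideal A -> submod B ->
  mul_ideal A B `<=` base D -> B 1 -> integral_ideal (mul_ideal A B).
Proof.
move=> [sA _ [x Ax x0]] sB ABD B1; split=> //; first exact: mul_ideal_submod.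
by exists x => //; rewrite -[x]mulr1; exact: mem_mul_ideal.
Qed.

Lemma inv_ideal1 A : A `<=` base D -> inv_ideal A 1.
Proof. by move=> AD y /AD; rewrite mul1r. Qed.

(** Sharpness applied to xD and A * (x A^-1), with x in A, gives xD = A'B'
    where A' is inside A_v and B' inside x A^-1; dividing an expression of x by
    x yields the claim. *)
Lemma sharp_v_closure_inverse A : sharp_domain D -> integral_ideal A ->
  mul_ideal (v_closure A) (inv_ideal A) 1.
Proof.
move=> sharp iA; have [sA AD [x Ax x0]] := iA.
have [J0 JD JZ] := inv_ideal_submod A.
pose B := [set x * j | j in inv_ideal A].
have iB : integral_ideal B.
  split; first split.
  - by exists 0 => //; rewrite mulr0.
  - move=> _ _ [j Jj <-] [k Jk <-].
    by exists (j + k); [exact: JD|rewrite mulrDr].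
  - by move=> a _ [j Jj <-]; exists (tofrac a * j); [exact: JZ|rewrite mulrCA].
  - by move=> _ [j Jj <-]; rewrite mulrC; apply: Jj.
  - by exists x => //; exists 1; [exact: inv_ideal1|rewrite mulr1].
have AB_x : mul_ideal A B `<=` principal x.
  apply: mul_ideal_min; first exact: principal_submod.
  move=> a _ Aa [j Jj <-]; have [c _ ca] := Jj _ Aa.
  by exists c => //; rewrite ca; ring.
have [A' [B' [_ _ AA' BB' E]]] :=
  sharp_integral sharp (principal_integral (AD _ Ax) x0) iA iB AB_x.
have div a b : A' a -> B' b -> base D (x^-1 * (a * b)).
  move=> A'a B'b; apply: principal_div => //.
  by rewrite E; exact: mem_mul_ideal.
have: mul_ideal A' B' x by rewrite -E; exact: mem_principal.
rewrite -(mulVf x0) => -[s [hs {2}->]].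
exists [seq (p.1, x^-1 * p.2) | p <- s].
rewrite big_map mulr_sumr; split; last first.
  by apply: eq_bigr => p _; rewrite /= mulrCA.
move=> _ /mapP[p /hs[A'p B'p] ->] /=; split.
  move=> j Jj; have := div _ _ A'p (BB' (x * j) (ex_intro2 _ _ j Jj erefl)).
  by rewrite (mulrCA p.1) mulKf.
move=> a Aa; have := div _ _ (AA' _ Aa) B'p.
by congr base; ring.
Qed.

(** Sharpness applied to A + B^2, which contains (A + B)^2: coprimality forces
    both factors to be A + B, so that A + B^2 = (A + B)^2. *)
Lemma coprime_comaximal A B : sharp_domain D ->
  integral_ideal A -> has_inverse A -> integral_ideal B -> has_inverse B ->
  inv_ideal (sum_ideal A B) `<=` base D -> sum_ideal A B 1.
Proof.
move=> sharp iA A1 iB B1 cop.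
have iS := sum_integral iA iB.
have [[sA AD [x Ax x0]] [sB BD _]] := (iA, iB).
set S := sum_ideal A B in iS *; have [sS SD _] := iS.
have AS : A `<=` S by exact: sum_idealL.
have BS : B `<=` S by exact: sum_idealR.
have sAB := mul_ideal_submod B sA; have sBB := mul_ideal_submod B sB.
have sAS := mul_ideal_submod S sA.
have BB_B : mul_ideal B B `<=` B.
  by apply: mul_ideal_min => // a b /BD Da Bb; exact: submod_mul.
(* For j in A^-1, l in B^-1 and z in A and B, the product j * l * z maps A + B
   into D, because j * z and l * z are in D; so it is in D by coprimality. *)
have cap z : A z -> B z -> mul_ideal A B z.
  move=> Az Bz; apply: (mem_of_mul_ideal1 A1) => // a j Aa Jj.
  apply: (mem_of_mul_ideal1 B1) => // b l Bb Ll.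
  have -> : b * l * (a * j * z) = (j * l * z) * (a * b) by ring.
  apply: submod_mul => //; last exact: mem_mul_ideal.
  apply: cop => _ [c Ac [d Bd <-]].
  have -> : j * l * z * (c + d) = (j * c) * (l * z) + (j * z) * (l * d) by ring.
  have [_ DD _] := base_submod.
  by apply: DD; apply: (submod_mul base_submod);
    [apply: Jj|apply: Ll|apply: Jj|apply: Ll].
pose I := sum_ideal A (mul_ideal B B).
have iI : integral_ideal I.
  split; first exact: sum_ideal_submod.
    by apply: sum_ideal_min => //; [exact: base_submod|exact: subset_trans BD].
  by exists x => //; exact: sum_idealL.
have SS_I : mul_ideal S S `<=` I.
  apply: mul_ideal_min; first by case: iI.
  move=> _ e [a Aa [b Bb <-]] Se; have [c Ac [d Bd cd]] := Se.
  exists (a * e + b * c).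
    have [_ dA _] := sA.
    by apply: dA; [rewrite mulrC|]; apply: submod_mul => //;
      [exact: SD|exact: BD].
  by exists (b * d); [exact: mem_mul_ideal|rewrite -cd; ring].
have [A' [B' [iA' iB' SA' SB' E]]] := sharp_integral sharp iI iS iS SS_I.
(* The common argument for both factors: if B C is inside A + B^2, then the
   A-part of a product b * c is in B as well, hence in AB; so B C is inside
   B (A + B), and B cancels. *)
have sub_S C : integral_ideal C ->
    (forall b c, B b -> C c -> I (b * c)) -> C `<=` S.
  move=> [sC CD C0] CB c Cc; apply: (mem_of_mul_ideal1 B1) => // b l Bb Ll.
  have [a Aa [q BBq e]] := CB _ _ Bb Cc.
  have ABa : mul_ideal A B a.
    apply: cap => //; rewrite -[a](addrK q) e; apply: submod_sub => //.
      by rewrite mulrC; apply: submod_mul => //; exact: CD.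
    exact: BB_B.
  have -> : b * l * c = l * a + l * q by rewrite -mulrDr e; ring.
  have [_ dS _] := sS; apply: dS.
    apply: AS; apply: mul_ideal_scale ABa => // a' b' Aa' Bb'.
    by rewrite mulrCA mulrC; apply: submod_mul => //; exact: Ll.
  apply: BS; apply: mul_ideal_scale BBq => // b1 b2 Bb1 Bb2.
  by rewrite mulrA; apply: submod_mul => //; exact: Ll.
have A'S : A' `<=` S.
  apply: sub_S => // b c /BS /SB' B'b A'c.
  by rewrite E mulrC; exact: mem_mul_ideal.
have B'S : B' `<=` S.
  apply: sub_S => // b c /BS /SA' A'b B'c.
  by rewrite E; exact: mem_mul_ideal.
(* From A'B' = (A + B)^2 = A (A + B) + B^2, the B^2-part of an element of A is
   in A as well, hence in AB. *)
have A_AS : A `<=` mul_ideal A S.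
  move=> a Aa.
  have [p ASp [q BBq e]] : sum_ideal (mul_ideal A S) (mul_ideal B B) a.
    have: mul_ideal A' B' a by rewrite -E; exact: sum_idealL.
    have sT := sum_ideal_submod sAS sBB.
    apply: mul_ideal_min => // _ e /A'S [c Ac [b Bb <-]] /B'S Se.
    have [d Ad [b' Bb' de]] := Se.
    exists (c * e + d * b).
      have [_ dAS _] := sAS.
      by apply: dAS; apply: mem_mul_ideal => //; exact: BS.
    by exists (b * b'); [exact: mem_mul_ideal|rewrite -de; ring].
  rewrite -e; have [_ dAS _] := sAS; apply: dAS => //.
  have: mul_ideal A B q.
    apply: cap; last exact: BB_B.
    rewrite -[q](addKr p) e addrC; apply: submod_sub => //.
    apply: mul_ideal_min ASp => // a1 s1 Aa1 /SD Ds1.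
    by rewrite mulrC; exact: submod_mul.
  apply: mul_ideal_min => // a1 b1 Aa1 Bb1.
  by apply: mem_mul_ideal => //; exact: BS.
apply: (mem_of_mul_ideal1 A1) => // a j Aa Jj; rewrite mulr1 mulrC.
apply: mul_ideal_scale (A_AS _ Aa) => // a1 s1 Aa1 Ss1.
by rewrite mulrA; apply: submod_mul => //; exact: Jj.
Qed.

(** Dividing A and B by (A + B)_v, that is, multiplying them by J = (A + B)^-1,
    makes them coprime. *)
Lemma sum_has_inverse A B : sharp_domain D ->
  integral_ideal A -> has_inverse A -> integral_ideal B -> has_inverse B ->
  has_inverse (sum_ideal A B).
Proof.
move=> sharp iA A1 iB B1; have iH := sum_integral iA iB.
have [[sA AD A0] [sB BD B0]] := (iA, iB).
set H := sum_ideal A B in iH *; have [sH HD _] := iH.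
pose J := inv_ideal H; have sJ : submod J by exact: inv_ideal_submod.
have HJ_D : mul_ideal H J `<=` base D.
  apply: mul_ideal_min => [|h j Hh Jj]; first exact: base_submod.
  by rewrite mulrC; apply: Jj.
have VJ1 := sharp_v_closure_inverse sharp iH.
have div C : integral_ideal C -> has_inverse C -> C `<=` H ->
    integral_ideal (mul_ideal C J) /\ has_inverse (mul_ideal C J).
  move=> iC C1 CH; have [sC CD C0] := iC; split.
    apply: mul_integral => //; last exact: inv_ideal1.
    apply: mul_ideal_min => [|c j /CH Hc Jj]; first exact: base_submod.
    by apply: HJ_D; exact: mem_mul_ideal.
  (* The inverse of C J is C^-1 J^-1, where J^-1 = H_v. *)
  pose L := mul_ideal (v_closure H) (inv_ideal C).
  have sL : submod L by apply: mul_ideal_submod; exact: inv_ideal_submod.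
  apply: (has_inverseI (J := L)).
    apply: mul_ideal_min => [|x l CJx Ll]; first exact: base_submod.
    apply: mul_ideal_scale Ll => [|v i Vv Ii]; first exact: base_submod.
    rewrite mulrC; apply: mul_ideal_scale CJx => [|c j Cc Jj].
      exact: base_submod.
    have -> : v * i * (c * j) = (v * j) * (i * c) by ring.
    by apply: (submod_mul base_submod); [apply: Vv|apply: Ii].
  apply: (mem_of_mul_ideal1 C1) => [|c i Cc Ii].
    exact/mul_ideal_submod/mul_ideal_submod.
  apply: (mem_of_mul_ideal1 VJ1) => [|v j Vv Jj].
    exact/mul_ideal_submod/mul_ideal_submod.
  have -> : v * j * (c * i * 1) = (c * j) * (v * i) by ring.
  by apply: mem_mul_ideal; exact: mem_mul_ideal.
have AH : A `<=` H by exact: sum_idealL.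
have BH : B `<=` H by exact: sum_idealR.
have [iAJ AJ1] := div A iA A1 AH.
have [iBJ BJ1] := div B iB B1 BH.
have sHJ : submod (mul_ideal H J) by exact: mul_ideal_submod.
have [] : sum_ideal (mul_ideal A J) (mul_ideal B J) `<=` mul_ideal H J /\
  sum_ideal (mul_ideal A J) (mul_ideal B J) 1; last by move=> + h; apply.
split.
  apply: sum_ideal_min => //; apply: mul_ideal_min => // c j Cc Jj;
    by apply: mem_mul_ideal => //; [exact: AH || exact: BH].
apply: coprime_comaximal => // x xinv.
(* x multiplies J into H^-1 = J, and J has the inverse H_v; so x is in D. *)
have xJ j : J j -> J (x * j).
  move=> Jj _ [a Aa [b Bb <-]]; rewrite -mulrA; apply: xinv.
  exists (a * j); first exact: mem_mul_ideal.
  by exists (b * j); [exact: mem_mul_ideal|ring].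
apply: (mem_of_mul_ideal1 VJ1) => [|v j Vv Jj]; first exact: base_submod.
by rewrite -mulrA; apply: Vv; rewrite mulrC; exact: xJ.
Qed.

(** * Finitely generated ideals *)

Local Notation span := (Defs.span (@tofrac D)).

Lemma span_cons x s : span (x :: s) = sum_ideal (principal x) (span s).
Proof.
apply/seteqP; split=> y.
  move=> [c ->]; rewrite big_ord_recl /=; exists (tofrac (c 0%N) * x).
    by exists (c 0%N).
  by eexists; last by []; exists (fun i => c i.+1).
move=> [_ [a _ <-] [_ [c ->] <-]].
exists (fun i => if i is i'.+1 then c i' else a).
by rewrite big_ord_recl.
Qed.

Lemma span_nil : span [::] = [set 0].
Proof.
apply/seteqP; split=> y; first by move=> [c ->]; rewrite big_ord0.
by move=> ->; exists (fun=> 0); rewrite big_ord0.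
Qed.

Lemma span_submod s : submod (span s).
Proof.
elim: s => [|x s IH].
  by rewrite span_nil; split=> [//|x y -> ->|a x ->]; rewrite ?addr0 ?mulr0.
by rewrite span_cons; apply: sum_ideal_submod => //; exact: principal_submod.
Qed.

Lemma mem_span s x : x \in s -> span s x.
Proof.
elim: s => // y s IH; rewrite inE span_cons => /orP[/eqP <-|/IH sx].
  by apply: sum_idealL; [exact: span_submod|exact: mem_principal].
by apply: sum_idealR => //; exact: principal_submod.
Qed.

Lemma span_min N s : submod N -> (forall x, x \in s -> N x) -> span s `<=` N.
Proof.
move=> sN; elim: s => [|x s IH] sub_N.
  by rewrite span_nil => _ ->; case: sN.
rewrite span_cons; apply: sum_ideal_min => //.
  by apply: principal_min => //; apply: sub_N; rewrite inE eqxx.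
by apply: IH => y ys; apply: sub_N; rewrite inE ys orbT.
Qed.

(** Adding generators one at a time keeps the ideal invertible, except that both
    the new generator and the previous ideal may be zero. *)
Lemma span_has_inverse s : sharp_domain D ->
  (forall x, x \in s -> base D x) -> nonzero (span s) -> has_inverse (span s).
Proof.
move=> sharp; elim: s => [|x s IH] sD.
  by rewrite span_nil => -[_ -> /eqP].
have Dx : base D x by apply: sD; rewrite inE eqxx.
have {}sD y : y \in s -> base D y by move=> ys; apply: sD; rewrite inE ys orbT.
rewrite span_cons; have [->|x0] := eqVneq x 0.
  suff -> : sum_ideal (principal 0) (span s) = span s by exact: IH.
  apply/seteqP; split; last by apply: sum_idealR; exact: principal_submod.
  have ss := span_submod s.
  by apply: sum_ideal_min => //; apply: principal_min => //; case: ss.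
move=> _; have [s0|s0] := pselect (nonzero (span s)).
  apply: sum_has_inverse => //.
  - exact: principal_integral.
  - exact: principal_has_inverse.
  - split=> //; first exact: span_submod.
    by apply: span_min => //; exact: base_submod.
  - exact: IH.
suff -> : sum_ideal (principal x) (span s) = principal x.
  exact: principal_has_inverse.
have sx := principal_submod x.
apply/seteqP; split; last by apply: sum_idealL; exact: span_submod.
apply: sum_ideal_min => // y sy; have [->|y0] := eqVneq y 0; first by case: sx.
by case: s0; exists y.
Qed.

(** * The three classes of domains *)

(** Nonzero finitely generated ideals equal their v-closure, so A is a
    t-ideal. *)
Lemma TV_has_inverse A : sharp_domain D -> TV_domain D ->
  integral_ideal A -> has_inverse A.
Proof.
move=> sharp TV iA; have [sA AD [a Aa a0]] := iA.
suff /TV[_ e] : t_ideal A.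
  by rewrite /has_inverse [X in mul_ideal X]e; exact: sharp_v_closure_inverse.
split.
  split; last by exists a.
  split=> //; exists 1; first exact: oner_neq0.
  by move=> x /AD; rewrite tofrac1 mul1r.
apply/seteqP; split=> x.
  (* The generator a keeps the span nonzero when x = 0. *)
  move=> Ax; exists [:: x; a]; split.
  - by exists a => //; apply: mem_span; rewrite !inE eqxx orbT.
  - by apply: span_min => // y; rewrite !inE => /orP[]/eqP ->.
  - by apply: sub_v_closure; apply: mem_span; rewrite inE eqxx.
move=> [s [s0 sA' vx]]; apply: (sA'); move: vx.
apply: has_inverse_v_closure; first exact: span_submod.
by apply: span_has_inverse => // y /mem_span/sA'/AD.
Qed.

Lemma Noetherian_has_inverse A : sharp_domain D -> Noetherian_domain D ->
  integral_ideal A -> has_inverse A.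
Proof.
move=> sharp noeth iA; have [sA AD A0] := iA.
have [[iI _] e] := (integral_ideal_preimage iA, image_preimage_tofrac AD).
have [s es] := noeth _ iI.
suff eA : span [seq tofrac d | d <- s] = A.
  rewrite -eA; apply: span_has_inverse => //; last by rewrite eA.
  by move=> _ /mapP[d _ ->]; exact: base_tofrac.
rewrite -[RHS]e es; apply/seteqP; split=> x.
  move=> [c]; rewrite size_map => ->.
  exists (\sum_(i < size s) c i * s`_i); first by exists c.
  by rewrite rmorph_sum; apply: eq_bigr => i _; rewrite (nth_map 0) // rmorphM.
move=> [_ [c ->] <-]; exists c; rewrite size_map rmorph_sum.
by apply: eq_bigr => i _; rewrite (nth_map 0) // rmorphM.
Qed.

(** Fix a <> 0 in A.  Only finitely many valuations are nonzero at a; at those,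
    A has an element b i of least value, since values on A are nonnegative
    integers, while at all others a itself has the least value 0.  So a and the
    b i reach the least value on A at every valuation, which is all that A^-1
    depends on. *)
Lemma Krull_v_finite A : Krull_domain D -> integral_ideal A ->
  exists s, (forall x, x \in s -> A x) /\
    nonzero (span s) /\ A `<=` v_closure (span s).
Proof.
move=> [T [v [dv vD vfin]]] [sA AD [a Aa a0]].
have v_ge0 z i : base D z -> z != 0 -> 0 <= v i z.
  by move=> Dz z0; apply: (vD z z0).1.
have vmin i : exists b, [/\ A b, b != 0 &
    forall y, A y -> y != 0 -> v i b <= v i y].
  have val y : A y -> y != 0 -> exists n : nat, v i y = n.
    move=> /AD Dy y0; have := v_ge0 y i Dy y0.
    by case: (v i y) => // n; exists n.
  pose P := [pred n : nat | `[< exists b, [/\ A b, b != 0 & v i b = n] >]].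
  have exP : exists n, P n.
    by have [n an] := val a Aa a0; exists n; apply/asboolP; exists a.
  case: (ex_minnP exP) => n /asboolP[b [Ab b0 vb]] nmin; exists b; split=> //.
  move=> y Ay y0; have [m ym] := val y Ay y0.
  rewrite vb ym lez_nat; apply: nmin.
  by apply/asboolP; exists y.
have [b bP] := choice vmin.
have /finite_seqP[t et] := finite_image b (vfin a a0).
have bt i : v i a != 0 -> b i \in t.
  by move=> via; have: [set` t] (b i) by rewrite -et; exists i.
exists (a :: t); split.
  move=> x; rewrite inE => /orP[/eqP -> //|xt].
  have : [set` t] x by [].
  by rewrite -et => -[i _ <-]; case: (bP i).
split; first by exists a => //; apply: mem_span; rewrite inE eqxx.
move=> y Ay x xinv; have [->|xy0] := eqVneq (y * x) 0.
  by case: base_submod.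
have [y0 x0] : y != 0 /\ x != 0 by move: xy0; rewrite mulf_eq0 => /norP.
apply/(vD _ xy0) => i; have [vM _ _] := dv i; rewrite vM //.
have vxs c : c \in a :: t -> c != 0 -> 0 <= v i x + v i c.
  move=> /mem_span sc c0; rewrite -vM //.
  by apply: v_ge0; [exact: xinv|rewrite mulf_neq0].
have [via|via] := eqVneq (v i a) 0.
  have := vxs a; rewrite inE eqxx via addr0 => /(_ isT a0) vx.
  by apply: addr_ge0 => //; apply: v_ge0 => //; exact: AD.
have [Ab b0 /(_ y Ay y0) le] := bP i.
apply: le_trans (vxs (b i) _ b0) _; first by rewrite inE bt ?orbT.
by rewrite addrC lerD2r.
Qed.

Lemma Krull_has_inverse A : sharp_domain D -> Krull_domain D ->
  integral_ideal A -> has_inverse A.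
Proof.
move=> sharp krull iA; have [sA AD _] := iA.
have [s [sA' [s0 A_v]]] := Krull_v_finite krull iA.
have s1 : has_inverse (span s) by apply: span_has_inverse => // x /sA' /AD.
suff -> : A = span s by [].
apply/seteqP; split; last exact: span_min.
apply: subset_trans A_v _; apply: has_inverse_v_closure => //.
exact: span_submod.
Qed.

End Modules.

Theorem corollary12 (D : idomainType) (hD : sharp_domain D) :
  (TV_domain D -> Dedekind_domain D) /\
  (Noetherian_domain D \/ Krull_domain D -> Dedekind_domain D).
Proof.
have dedekind :
    (forall A : set {fraction D}, integral_ideal A -> has_inverse A) ->
    Dedekind_domain D.
  move=> inv I /integral_ideal_image iI.
  by apply: has_inverse_invertible => //; exact: inv.
split=> [TV|[noeth|krull]]; apply: dedekind => A iA.
- exact: TV_has_inverse.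
- exact: Noetherian_has_inverse.
- exact: Krull_has_inverse.
Qed.
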